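(* There exists a fractional set $\alpha$ for which $\|\alpha\|>1$, $\alpha-\alpha$ is strictly spartan (so that $\|\alpha-\alpha\|=\|\alpha\|^2$), and $\|\alpha+\alpha\|\le\|\alpha\|^{1.7354}$.
   Context: A fractional dilate is a map $\gamma:\mathbb{Z}\to[0,\infty)$ with finite support $\mathrm{supp}(\gamma)$. Its size is $\|\gamma\|=\inf_{0\le p\le 1}\sum_{n\in\mathrm{supp}(\gamma)}\gamma(n)^p$. A fractional set is a fractional dilate $\alpha$ with $\alpha(n)\le 1$ for all $n\in\mathbb{Z}$. For a fractional set $\alpha$ and an integer $k$, $\alpha+k\cdot\alpha$ is the fractional dilate $(\alpha+k\cdot\alpha)(n)=\sum_{(i,j):\,i+kj=n}\alpha(i)\alpha(j)$; $\alpha+\alpha$ and $\alpha-\alpha$ denote the cases $k=1$ and $k=-1$. A fractional dilate $\gamma$ is strictly spartan if $\sum_{n\in\mathrm{supp}(\gamma)}\gamma(n)\log\gamma(n)<0$. *)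

(* Defs.v *)
From mathcomp Require Import all_boot all_order all_algebra.
From mathcomp Require Import all_classical all_reals all_analysis.
Set Implicit Arguments.
Unset Strict Implicit.
Unset Printing Implicit Defensive.
Import Order.TTheory GRing.Theory Num.Theory.
Local Open Scope classical_set_scope.
Local Open Scope ring_scope.

Definition supp (R : realType) (g : int -> R) : set int := [set n | g n != 0].

Definition fractional_dilate (R : realType) (g : int -> R) : Prop :=
  (forall n, 0 <= g n) /\ finite_set (supp g).

Definition fractional_set (R : realType) (a : int -> R) : Prop :=
  fractional_dilate a /\ (forall n, a n <= 1).

(* At p = 0 each point of the support contributes 1. *)
Definition dilate_size (R : realType) (g : int -> R) : R :=
  inf [set \sum_(n \in supp g) g n `^ p | p in `[0, 1]].

(* For k = 0 the index set is infinite; [\sum_(_ \in _)] only requires finitely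
   many nonzero terms, which holds as soon as [a] has finite support. *)
Definition add_dilate (R : realType) (k : int) (a : int -> R) : int -> R :=
  fun n => \sum_(ij \in [set ij : int * int | ij.1 + k * ij.2 = n])
              a ij.1 * a ij.2.

Definition strictly_spartan (R : realType) (g : int -> R) : Prop :=
  \sum_(n \in supp g) g n * ln (g n) < 0.

Lemma add_dilate_fractional_dilate (R : realType) (k : int) (a : int -> R) :
  fractional_dilate a -> fractional_dilate (add_dilate k a).
Proof.
move=> [a0 fa]; split=> [n|].
  by apply: fsumr_ge0 => ij _; rewrite mulr_ge0.
apply: (@sub_finite_set _ _
  ((fun ij : int * int => ij.1 + k * ij.2) @` (supp a `*` supp a))).
  move=> n /= nz; apply: contrapT => nim; move/eqP: nz; apply.
  apply: fsbig1 => -[i j] /= ijn; apply/eqP; rewrite mulf_eq0.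
  apply: contrapT => /negP; rewrite negb_or => /andP[ai aj].
  by apply: nim; exists (i, j).
exact/finite_image/finite_setX.
Qed.

(* Main.v *)
Require Import Defs.
From mathcomp Require Import all_boot all_order all_algebra.
From mathcomp Require Import all_classical all_reals all_analysis.
From mathcomp Require Import ring lra zify.
Set Implicit Arguments.
Unset Strict Implicit.
Unset Printing Implicit Defensive.
Import Order.TTheory GRing.Theory Num.Theory.
Local Open Scope classical_set_scope.
Local Open Scope ring_scope.

(** The example is a scaled-down lattice simplex. Let S be the set of vectors in
    N^(n+1) with coordinate sum k, written as integers in base 2k+1 so that no
    sum or difference is blurred by carries, and let alpha be c times the
    indicator of S for some c <= 1. Write N = #|S| = 'C(n + k, n).

    The size of alpha is its mass c N. For the sumset the exponent p = 0 is the
    right choice: S + S is the simplex with coordinate sum 2k, so the size of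
    alpha + alpha is at most 'C(n + 2k, n), and this does not depend on c.

    The factor c is there to make differences spartan. Given x and y in S, the
    pairs in S with the same difference as (x, y) are counted by the simplex
    with coordinate sum W = \sum_i min(x_i, y_i): what remains after the
    positive part of x - y is removed. So (alpha - alpha)(x - y) is at most
    c^2 'C(n + W, n), whose logarithm is at most
    2 ln c - n ln (1 - s) - W ln s for every s in ]0, 1[. This bound is affine
    in W, hence averaging over x and y only needs the mean of W, which is at
    most (n + 1) q / (1 - q) with q = (k / (n + k))^2, because a coordinate of
    a point of S reaches j with probability at most (k / (n + k))^j
    ([simplex_spartan]). Once alpha - alpha is strictly spartan, convexity in p
    puts the infimum defining its size at p = 1, so the size is the mass
    (c N)^2 ([strictly_spartan_size]).

    Take n = 61 m and k = 4 m, so that k / (n + k) = 4 / 65, and let s = q, which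
    is (4 / 65)^2; this s minimises the affine bound at W = n q / (1 - q). Up to
    terms of order ln m, the logarithms of 'C(n + 2k, n), N and the largest
    c that this allows are then m X, m Y and m beta with explicit X, Y and beta,
    so the theorem comes down to X < 1.7354 (Y + beta) ([exponent_gap]) and to m
    being large. The ratio X / (Y + beta) is 1.7353985 to seven decimals. For a general
    slope t = k / (n + k) the corresponding ratio has minimum about 1.7353980,
    near t = 0.06185, and 4 / 65 is a fraction with small terms close enough. *)

(** * Sizes of fractional dilates *)

Section DilateSize.
Variable R : realType.
Implicit Types g : int -> R.

Lemma has_lbound_size_sums g :
  has_lbound [set \sum_(n \in supp g) g n `^ p | p in `[0, 1]].
Proof. by exists 0 => _ [p _ <-]; apply: fsumr_ge0 => n _; apply: powR_ge0. Qed.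

Lemma dilate_size_le g (p : R) : 0 <= p <= 1 ->
  dilate_size g <= \sum_(n \in supp g) g n `^ p.
Proof.
move=> p01; apply: ge_inf; first exact: has_lbound_size_sums.
by exists p; rewrite //= in_itv.
Qed.

Lemma dilate_size_eq_mass g : fractional_dilate g ->
  (forall p : R, 0 <= p <= 1 ->
    \sum_(n \in supp g) g n <= \sum_(n \in supp g) g n `^ p) ->
  dilate_size g = \sum_(n \in supp g) g n.
Proof.
move=> [g0 _] le_mass; apply/eqP; rewrite eq_le; apply/andP; split.
  rewrite (_ : \sum_(n \in supp g) g n = \sum_(n \in supp g) g n `^ 1).
    by apply: dilate_size_le; rewrite ler01 lexx.
  by apply: eq_fsbigr => n _; rewrite powRr1.
apply: lb_le_inf; last by move=> _ [p + <-]; rewrite /= in_itv; apply: le_mass.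
by exists (\sum_(n \in supp g) g n `^ 0), 0; rewrite //= in_itv /= lexx ler01.
Qed.

Lemma dilate_gt0 g n : fractional_dilate g -> supp g n -> 0 < g n.
Proof. by move=> [g0 _] /= gn; rewrite lt_neqAle eq_sym gn g0. Qed.

(** When all values are at most 1, the powers decrease with the exponent. *)
Lemma fractional_set_size g : fractional_set g ->
  dilate_size g = \sum_(n \in supp g) g n.
Proof.
move=> [dg g1]; apply: dilate_size_eq_mass => // p /andP[_ p1].
have [_ fs] := dg.
rewrite !fsbig_finite // big_seq [leRHS]big_seq; apply: ler_sum => n.
rewrite in_fset_set // inE => sn.
by apply: ger1_powR => //; rewrite g1 dilate_gt0.
Qed.

(** The sum of the powers is convex in the exponent, and the spartan sum is its
    derivative at 1, so being negative there forces the minimum over [0, 1] to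
    the right endpoint. Convexity enters through the tangent inequality
    g^p >= g + (p - 1) g ln g. *)
Lemma strictly_spartan_size g : fractional_dilate g -> strictly_spartan g ->
  dilate_size g = \sum_(n \in supp g) g n.
Proof.
move=> dg; rewrite /strictly_spartan => sp.
apply: dilate_size_eq_mass => // p /andP[_ p1].
have [_ fs] := dg.
apply: (@le_trans _ _ (\sum_(n \in supp g) g n +
    (p - 1) * \sum_(n \in supp g) g n * ln (g n))).
  by rewrite lerDl mulr_le0 ?subr_le0 // ltW.
rewrite mulr_fsumr !fsbig_finite // -big_split /= big_seq [leRHS]big_seq.
apply: ler_sum => n; rewrite in_fset_set // inE => sn.
have gn := dilate_gt0 dg sn.
rewrite /powR gt_eqF //.
have -> : p * ln (g n) = ln (g n) + (p - 1) * ln (g n) by ring.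
rewrite expRD lnK // mulrCA -[X in X + _]mulr1 -mulrDr.
by rewrite ler_pM2l // expR_ge1Dx.
Qed.

End DilateSize.

(** * Images of finite sets with a constant weight *)

Section WeightedImage.
Variable R : realType.

(** Counting with multiplicity makes these dilates stable under [add_dilate]
    ([add_dilate_weighted_image]), so alpha, alpha + alpha and alpha - alpha are
    all of this form. *)
Definition weighted_image (T : finType) (A : {set T}) (phi : T -> int) (c : R) :
  int -> R := fun n => \sum_(x in A | phi x == n) c.

Lemma sum_fibers (V : eqType) (T : finType) (A : {set T}) (phi : T -> V)
    (H : T -> V -> R) :
  \sum_(v <- undup [seq phi x | x in A]) \sum_(x in A | phi x == v) H x v =
  \sum_(x in A) H x (phi x).
Proof.
under eq_bigr do rewrite big_mkcondr.
rewrite exchange_big /=; apply: eq_bigr => x xA.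
rewrite (bigD1_seq (phi x)) ?undup_uniq //=; last first.
  by rewrite mem_undup fintype.image_f.
by rewrite eqxx big1 ?addr0 // => v; rewrite eq_sym => /negPf ->.
Qed.

Variables (T : finType) (A : {set T}) (phi : T -> int) (c : R).
Hypothesis c0 : 0 < c.
Local Notation w := (weighted_image A phi c).

Lemma weighted_imageE n :
  w n = c * #|finset (fun x => (x \in A) && (phi x == n))|%:R.
Proof.
rewrite mulr_natr -sumr_const /weighted_image.
by apply: eq_bigl => x; rewrite inE.
Qed.

Lemma weighted_image_ge0 n : 0 <= w n.
Proof. by apply: sumr_ge0 => x _; apply: ltW. Qed.

Lemma weighted_image_gt0 x : x \in A -> 0 < w (phi x).
Proof.
move=> xA; rewrite weighted_imageE mulr_gt0 // ltr0n; apply/card_gt0P.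
by exists x; rewrite inE xA eqxx.
Qed.

Lemma supp_weighted_image : supp w = [set` undup [seq phi x | x in A]].
Proof.
apply/seteqP; split=> n /=; rewrite mem_undup.
  move=> wn; apply/fintype.imageP; apply: contrapT => nx; move/eqP: wn; apply.
  rewrite /weighted_image big1 // => x /andP[xA /eqP xn].
  by case: nx; exists x.
by move=> /fintype.imageP[x xA ->]; apply/lt0r_neq0/weighted_image_gt0.
Qed.

Lemma fractional_dilate_weighted_image : fractional_dilate w.
Proof.
split; first exact: weighted_image_ge0.
by rewrite supp_weighted_image; apply: finite_seq.
Qed.

(** A sum over the support in which each value counts w times is a plain sum
    over A; this removes the integers from entropy computations. *)
Lemma sum_weighted_image (G : R -> R) :
  \sum_(n \in supp w) w n * G (w n) = \sum_(x in A) c * G (w (phi x)).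
Proof.
rewrite supp_weighted_image -fsbig_seq ?undup_uniq //.
rewrite -(sum_fibers _ _ (fun _ v => c * G (w v))).
by apply: eq_bigr => v _; rewrite -big_distrl.
Qed.

Lemma mass_weighted_image : \sum_(n \in supp w) w n = c * #|A|%:R.
Proof.
transitivity (\sum_(n \in supp w) w n * (fun=> 1) (w n)).
  by apply: eq_fsbigr => n _; rewrite mulr1.
by rewrite (sum_weighted_image (fun=> 1)) mulr1 sumr_const mulr_natr.
Qed.

(** At exponent 0 the sum counts the points of the support, and these are at
    most as many as the values of any map h through which phi factors. *)
Lemma supp_weighted_image_card (U : finType) (B : {set U}) (h : T -> U) :
  {in A, forall x, h x \in B} ->
  {in A &, forall x y, h x = h y -> phi x = phi y} ->
  \sum_(n \in supp w) w n `^ 0 <= #|B|%:R.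
Proof.
move=> hB hphi; rewrite supp_weighted_image -fsbig_seq ?undup_uniq //.
under eq_bigr do rewrite powRr0.
rewrite big_const_seq count_predT iter_addr_0 ler_nat cardE.
(* [psi] factors [phi] through [h]; the value 0 is only taken off [h @: A]. *)
pose psi u := if [pick x in A | h x == u] is Some x then phi x else 0.
rewrite -(size_map psi); apply: uniq_leq_size; first exact: undup_uniq.
move=> n; rewrite mem_undup => /fintype.imageP[x xA ->].
apply/mapP; exists (h x); first by rewrite mem_enum hB.
rewrite /psi; case: pickP => [y /andP[yA /eqP yx]|/(_ x)].
  exact: hphi.
by rewrite xA eqxx.
Qed.

Lemma add_dilate_weighted_image k :
  add_dilate k w =
  weighted_image (finset.setX A A) (fun p => phi p.1 + k * phi p.2) (c ^+ 2).
Proof.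
apply/funext => n; rewrite /add_dilate.
pose phi2 (p : T * T) := (phi p.1, phi p.2).
set r := undup [seq phi2 p | p in finset.setX A A].
have wE (ij : int * int) :
    w ij.1 * w ij.2 = \sum_(p in finset.setX A A | phi2 p == ij) c ^+ 2.
  rewrite /weighted_image big_distrlr /= pair_big /=.
  apply: eq_big => [[x y]|//]; case: ij => i j.
  rewrite finset.in_setX xpair_eqE /=.
  by do !case: (_ \in _); do !case: (_ == _).
transitivity (\sum_(ij <- r | ij.1 + k * ij.2 == n) w ij.1 * w ij.2).
  rewrite [RHS]bigfs ?undup_uniq //.
    by apply: eq_fsbigl; apply/seteqP; split=> ij /= /eqP.
  move=> ij _ ijr; rewrite wE big1 // => p /andP[pA /eqP pij].
  by move: ijr; rewrite mem_undup -pij => /fintype.imageP; case; exists p.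
rewrite big_mkcond /= /weighted_image [RHS]big_mkcondr.
rewrite -(sum_fibers _ phi2
  (fun _ ij => if ij.1 + k * ij.2 == n then c ^+ 2 else 0)).
apply: eq_bigr => ij _; rewrite wE; case: ifP => // _.
by rewrite big1.
Qed.

End WeightedImage.

(** * Entropy bounds for binomial coefficients *)

Section Binomial.

(** The left-hand side is one term of the expansion of (a + b)^(n + m). *)
Lemma bin_mul_exp_le1 (R : realDomainType) (n m : nat) (a b : R) :
  0 <= a -> 0 <= b -> a + b = 1 -> 'C(n + m, m)%:R * a ^+ n * b ^+ m <= 1.
Proof.
move=> a0 b0 ab1.
have E : (a + b) ^+ (n + m) = 1 by rewrite ab1 expr1n.
rewrite -[leRHS]E exprDn.
have mnm : (m < (n + m).+1)%N by rewrite ltnS leq_addl.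
rewrite (bigD1 (Ordinal mnm)) //= addnK [_%:R * _]mulr_natl mulrnAl lerDl.
by apply: sumr_ge0 => i _; rewrite mulrn_wge0 // mulr_ge0 ?exprn_ge0.
Qed.

(** A binomial law of integral mean k has its mode at k: in the
    expansion of (n + k)^(n + k), the term of index i + 1 is to the term of index
    i as (n + k - i) k is to (i + 1) n, which is an increase for i < k and not
    for i >= k. *)
Lemma mode_binomial (n k i : nat) : (0 < n)%N -> (i <= n + k)%N ->
  ('C(n + k, i) * (n ^ (n + k - i) * k ^ i) <= 'C(n + k, k) * (n ^ n * k ^ k))%N.
Proof.
move=> n0; pose T j := ('C(n + k, j) * (n ^ (n + k - j) * k ^ j))%N.
have TS j : (j < n + k)%N -> (T j.+1 * (j.+1 * n) = T j * ((n + k - j) * k))%N.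
  move=> jn; rewrite /T; have := mul_bin_left (n + k) j.
  have -> : (n ^ (n + k - j) = n * n ^ (n + k - j.+1))%N.
    by rewrite -(subnSK jn) expnS.
  rewrite expnS => E.
  transitivity (j.+1 * 'C(n + k, j.+1) *
      (n * n ^ (n + k - j.+1) * (k * k ^ j)))%N.
    by lia.
  by rewrite E; lia.
have -> : ('C(n + k, k) * (n ^ n * k ^ k) = T k)%N by rewrite /T addnK.
rewrite -/(T i) => ink; have [ik|ki] := leqP i k.
  have {ink}: forall d, (d <= k)%N -> (T (k - d) <= T k)%N.
    elim=> [|d IH] dk; first by rewrite subn0.
    apply: leq_trans (IH (ltnW dk)).
    have jn : (k - d.+1 < n + k)%N by lia.
    have := TS _ jn; rewrite (_ : (k - d.+1).+1 = k - d)%N; last by lia.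
    move=> E; rewrite -(@leq_pmul2r ((k - d) * n)); last first.
      by rewrite muln_gt0 n0; lia.
    by rewrite E leq_mul2l; apply/orP; right; nia.
  by move=> /(_ (k - i)%N); rewrite subKn //; apply; apply: leq_subr.
have : forall d, (k + d <= n + k)%N -> (T (k + d)%N <= T k)%N.
  elim=> [|d IH] dk; first by rewrite addn0.
  rewrite addnS; apply: leq_trans (IH _); last by lia.
  have := TS (k + d)%N; rewrite -addnS => /(_ dk) E.
  rewrite -(@leq_pmul2r ((k + d.+1) * n)); last by rewrite muln_gt0 n0; lia.
  by rewrite E leq_mul2l; apply/orP; right; nia.
by move=> /(_ (i - k)%N); rewrite subnKC; [exact|exact: ltnW].
Qed.

(** In the expansion of (n + k)^(n + k), the term of index k is the largest of
    n + k + 1. *)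
Lemma bin_lower_bound (n k : nat) : (0 < n)%N ->
  ((n + k) ^ (n + k) <= (n + k).+1 * ('C(n + k, k) * (n ^ n * k ^ k)))%N.
Proof.
move=> n0; rewrite [X in (X <= _)%N]expnDn.
rewrite -[X in (_ <= X * _)%N]card_ord -sum_nat_const.
apply: leq_sum => i _; apply: mode_binomial => //.
by rewrite -ltnS.
Qed.

(** Lowering k to k - 1 multiplies the coefficient by k / (n + k), and this
    ratio only decreases further down. *)
Lemma bin_shift_le (n k j : nat) : (j <= k)%N ->
  ('C(n + (k - j), n) * (n + k) ^ j <= 'C(n + k, n) * k ^ j)%N.
Proof.
elim: j => [|j IH] jk; first by rewrite subn0 !expn0.
have {}IH := IH (ltnW jk).
have E :
  ('C(n + (k - j.+1), n) * (n + (k - j)) = 'C(n + (k - j), n) * (k - j))%N.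
  have kj : (k - j = (k - j.+1).+1)%N by rewrite subnSK.
  rewrite kj !addnS mulnC mul_bin_down.
  by rewrite mulnC; congr (_ * _)%N; lia.
have [nk0|nk0] := posnP (n + (k - j)); first by lia.
rewrite -(@leq_pmul2r (n + (k - j))) //.
apply: (@leq_trans ('C(n + (k - j), n) * (n + k) ^ j * ((n + k) * (k - j)))).
  by rewrite mulnAC E expnS; lia.
apply: (@leq_trans ('C(n + k, n) * k ^ j * (k * (n + (k - j))))); last first.
  by rewrite expnS; lia.
by apply: leq_mul => //; nia.
Qed.
End Binomial.

Section LogBinomial.
Variable R : realType.

Lemma bin_addC (n m : nat) : 'C(n + m, m) = 'C(n + m, n).
Proof. by rewrite -bin_sub ?leq_addl // addnK. Qed.

(** The bound is affine in m for fixed s, which is what allows averaging over m;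
    it is tight when s is close to m / (n + m). *)
Lemma ln_bin_le (n m : nat) (s : R) : 0 < s < 1 ->
  ln 'C(n + m, n)%:R <= - n%:R * ln (1 - s) - m%:R * ln s.
Proof.
move=> /andP[s0 s1]; have s1' : 0 < 1 - s by lra.
have C0 : 0 < 'C(n + m, n)%:R :> R by rewrite ltr0n bin_gt0 leq_addr.
have := @bin_mul_exp_le1 R n m (1 - s) s (ltW s1') (ltW s0) (subrK s 1).
rewrite bin_addC => /ln_le0.
rewrite lnM ?posrE ?mulr_gt0 ?exprn_gt0 //.
rewrite lnM ?posrE ?exprn_gt0 //.
rewrite !lnXn //.
rewrite -![ln _ *+ _]mulr_natl.
move: (ln _) (ln _) (ln _) => a b c; lra.
Qed.

Lemma ln_bin_ge (n k : nat) : (0 < n)%N -> (0 < k)%N ->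
  (n + k)%:R * ln (n + k)%:R - n%:R * ln n%:R - k%:R * ln k%:R -
    ln (n + k).+1%:R
  <= ln 'C(n + k, n)%:R :> R.
Proof.
move=> n0 k0; have := bin_lower_bound k n0.
have C0 : (0 < 'C(n + k, n))%N by rewrite bin_gt0 leq_addr.
rewrite bin_addC -(ler_nat R) !natrM !natrX => H.
have p (i : nat) : (0 < i)%N -> 0 < i%:R :> R by rewrite ltr0n.
have nk0 : (0 < n + k)%N by rewrite addn_gt0 n0.
have : ln ((n + k)%:R ^+ (n + k)) <=
  ln ((n + k).+1%:R * ('C(n + k, n)%:R * (n%:R ^+ n * k%:R ^+ k))) :> R.
  by rewrite ler_ln // posrE ?mulr_gt0 ?exprn_gt0 ?p.
have e1 : 0 < n%:R ^+ n :> R by rewrite exprn_gt0 ?p.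
have e2 : 0 < k%:R ^+ k :> R by rewrite exprn_gt0 ?p.
have e3 : 0 < 'C(n + k, n)%:R :> R by rewrite p.
have e4 : 0 < (n + k).+1%:R :> R by rewrite p.
rewrite lnM ?posrE ?mulr_gt0 // lnM ?posrE ?mulr_gt0 // lnM ?posrE ?mulr_gt0 //.
rewrite !lnXn ?p // -![ln _ *+ _]mulr_natl.
move: (ln (n + k).+1%:R) (ln (n + k)%:R) (ln 'C(n + k, n)%:R) => a b c.
move: (ln n%:R) (ln k%:R) => d e; lra.
Qed.

End LogBinomial.

(** * Lattice simplices as sets of integers *)

Section Simplex.

Definition simplex (n k : nat) : {set n.+1.-tuple 'I_k.+1} :=
  finset (fun t : n.+1.-tuple 'I_k.+1 => \sum_(i <- t) i == k)%N.

Lemma card_simplex n k : #|simplex n k| = 'C(n + k, n).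
Proof. exact: card_ord_partitions. Qed.

Lemma sum_simplex n k t : t \in simplex n k -> (\sum_i tnth t i = k)%N.
Proof. by rewrite inE big_tuple => /eqP. Qed.

(** The form in which simplices are counted below: an injective encoding by
    vectors of coordinate sum m, with no bound on the entries to check. *)
Lemma card_le_simplex (T : finType) (S : {set T}) (n m : nat)
    (g : T -> 'I_n.+1 -> nat) :
  {in S, forall x, (\sum_i g x i = m)%N} ->
  {in S &, forall x y, g x =1 g y -> x = y} -> (#|S| <= 'C(n + m, n))%N.
Proof.
move=> gm g_inj.
pose G x : n.+1.-tuple 'I_m.+1 := [tuple inord (g x i) | i < n.+1].
have tG x i : x \in S -> tnth (G x) i = g x i :> nat.
  move=> xS; rewrite tnth_mktuple inordK // ltnS -(gm x xS).
  by rewrite (bigD1 i) //= leq_addr.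
rewrite -card_simplex -(@card_in_imset _ _ G S).
  apply: subset_leq_card; apply/fintype.subsetP => _ /imsetP[x xS ->].
  by rewrite inE big_tuple (eq_bigr (g x)) ?gm // => i _; apply: tG.
move=> x y xS yS Gxy; apply: g_inj => // i.
by rewrite -!tG // Gxy.
Qed.

Definition digits (B n : nat) (u : 'I_n -> nat) : nat := (\sum_i u i * B ^ i)%N.

Lemma digits_inj (B n : nat) (u v : 'I_n -> nat) :
  (forall i, u i < B)%N -> (forall i, v i < B)%N ->
  digits B u = digits B v -> u =1 v.
Proof.
elim: n u v => [|n IH] u v uB vB; first by move=> _ [].
rewrite /digits !big_ord_recl !expn0 !muln1.
have step (w : 'I_n.+1 -> nat) :
    (\sum_(i < n) w (lift ord0 i) * B ^ lift ord0 i =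
     digits B (fun i => w (lift ord0 i)) * B)%N.
  rewrite /digits big_distrl /=; apply: eq_bigr => i _.
  by rewrite /bump leq0n add1n expnS; lia.
rewrite !step => E; have B0 : (0 < B)%N by apply: leq_ltn_trans (uB ord0).
have E0 : u ord0 = v ord0.
  move/(congr1 (modn^~ B)): E.
  by rewrite ![(_ + _ * B)%N]addnC !modnMDl !modn_small.
move: E; rewrite E0 => /addnI /eqP; rewrite eqn_pmul2r // => /eqP E.
move=> i; case: (unliftP ord0 i) => [j ->|->] //.
exact: (IH (fun j => u (lift ord0 j)) (fun j => v (lift ord0 j))).
Qed.

Lemma digitsD (B n : nat) (u v : 'I_n -> nat) :
  digits B (fun i => u i + v i)%N = (digits B u + digits B v)%N.
Proof.
by rewrite /digits -big_split; apply: eq_bigr => i _; rewrite mulnDl.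
Qed.

(** The base 2k + 1 exceeds every coordinate of a sum of two points, so
    additions never carry; this makes [encode_add_eq] an equivalence, for
    differences as well as for sums. *)
Definition encode n k (x : n.+1.-tuple 'I_k.+1) : int :=
  (digits (2 * k).+1 (fun i => tnth x i : nat))%:Z.

Lemma encode_add_eq n k (x y x' y' : n.+1.-tuple 'I_k.+1) :
  encode x + encode y = encode x' + encode y' <->
  forall i, (tnth x i + tnth y i = tnth x' i + tnth y' i)%N.
Proof.
rewrite /encode -!PoszD -!digitsD; split=> [[]|E]; last first.
  by congr Posz; apply: eq_bigr => i _; rewrite E.
apply: digits_inj => i.
  by have := ltn_ord (tnth x i); have := ltn_ord (tnth y i); lia.
by have := ltn_ord (tnth x' i); have := ltn_ord (tnth y' i); lia.
Qed.

Lemma encode_inj n k : injective (@encode n k).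
Proof.
move=> x y xy; have /encode_add_eq E : encode x + encode x = encode y + encode y.
  by rewrite xy.
by apply: eq_from_tnth => i; apply: val_inj => /=; have := E i; lia.
Qed.

Definition overlap n k (x y : n.+1.-tuple 'I_k.+1) : nat :=
  (\sum_i minn (tnth x i) (tnth y i))%N.

(** A pair (p, q) with p - q = x - y is determined by p, and p dominates the
    positive part of x - y, that is x - min(x, y); subtracting it leaves an
    arbitrary vector of coordinate sum [overlap x y]. *)
Lemma card_same_difference n k x y : x \in simplex n k -> y \in simplex n k ->
  (#|finset (fun p => (p \in finset.setX (simplex n k) (simplex n k)) &&
       (encode p.1 - encode p.2 == encode x - encode y)%R)|
   <= 'C(n + overlap x y, n))%N.
Proof.
move=> xS yS.
have diff (p : n.+1.-tuple 'I_k.+1 * n.+1.-tuple 'I_k.+1) :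
    encode p.1 - encode p.2 == encode x - encode y ->
    forall i, (tnth p.1 i + tnth y i = tnth x i + tnth p.2 i)%N.
  move=> /eqP E; apply: (encode_add_eq p.1 y x p.2).1.
  by move: E; lia.
pose g (p : n.+1.-tuple 'I_k.+1 * n.+1.-tuple 'I_k.+1) (i : 'I_n.+1) : nat :=
  (tnth p.1 i - (tnth x i - minn (tnth x i) (tnth y i)))%N.
apply: (@card_le_simplex _ _ n _ g).
- case=> [p q]; rewrite inE finset.in_setX /= => /andP[/andP[pS _] pq].
  have {pq} E := @diff (p, q) pq.
  have sp := sum_simplex pS; have sx := sum_simplex xS.
  suff : (\sum_i g (p, q) i +
          \sum_i tnth x i = overlap x y + \sum_i tnth p i)%N.
    by rewrite sx sp => /addIn.
  rewrite /overlap -!big_split /=; apply: eq_bigr => i _; have := E i.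
  by rewrite /g /=; move: (tnth x i) (tnth y i) (tnth p i) => a b d; lia.
- move=> [p1 p2] [q1 q2]; rewrite !inE => /andP[_ Ep] /andP[_ Eq] pq.
  have {}Ep := @diff (p1, p2) Ep; have {}Eq := @diff (q1, q2) Eq.
  congr (_, _); apply: eq_from_tnth => i; apply: val_inj => /=;
    have := pq i; have := Ep i; have := Eq i; rewrite /g /=;
    move: (tnth x i) (tnth y i) => a b; lia.
Qed.

End Simplex.

(** * The mean overlap of two points of a simplex *)

Section Overlap.
Variable R : realType.
Variables n k : nat.
Hypothesis n0 : (0 < n)%N.
Local Notation S := (simplex n k).
Let theta : R := k%:R / (n + k)%:R.

(** Subtracting j from coordinate i maps these points into the simplex of
    coordinate sum k - j. *)
Lemma card_simplex_ge (i : 'I_n.+1) (j : nat) : (j <= k)%N ->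
  (#|finset (fun x => (x \in S) && (j <= tnth x i)%N)| <= 'C(n + (k - j), n))%N.
Proof.
move=> jk; pose g (x : n.+1.-tuple 'I_k.+1) (i' : 'I_n.+1) : nat :=
  (tnth x i' - j * (i' == i))%N.
have gE (x : n.+1.-tuple 'I_k.+1) i' :
    (j <= tnth x i)%N -> (g x i' + j * (i' == i) = tnth x i')%N.
  by rewrite /g; case: eqP => [->|_]; lia.
apply: (@card_le_simplex _ _ n _ g) => [x|x y].
  rewrite inE => /andP[xS xj].
  have := sum_simplex xS.
  rewrite -(eq_bigr _ (fun i' _ => gE x i' xj)) big_split /=.
  by rewrite -big_distrr /= -big_mkcond /= big_pred1_eq; lia.
rewrite !inE => /andP[_ xj] /andP[_ yj] gxy; apply: eq_from_tnth => i'.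
by apply: val_inj => /=; rewrite -(gE x i' xj) -(gE y i' yj) gxy.
Qed.

Lemma overlap_sum_indicator (x y : n.+1.-tuple 'I_k.+1) :
  overlap x y = (\sum_i \sum_(j < k) ((j < tnth x i) && (j < tnth y i)))%N.
Proof.
apply: eq_bigr => i _; move: (tnth x i) (tnth y i) => a b.
have ab : (minn a b <= k)%N by rewrite geq_min -ltnS ltn_ord.
under eq_bigr => j _ do rewrite -leq_min.
rewrite -(big_mkord xpredT (fun j => nat_of_bool (j < minn a b)%N)).
rewrite (big_cat_nat (leq0n _) ab) /=.
rewrite big_nat (eq_bigr (fun=> 1%N)); last by move=> j /= ->.
rewrite -big_nat sum_nat_const_nat muln1 subn0.
by rewrite big_nat big1 ?addn0 // => j /andP[]; rewrite leqNgt; case: (_ < _)%N.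
Qed.

(** For independent uniform x and y, the expectation of min(x_i, y_i) is the sum
    over j of P(x_i > j)^2; with the geometric tail bound this is at most a
    geometric series of ratio theta^2. *)
Lemma sum_overlap_le :
  \sum_(x in S) \sum_(y in S) (overlap x y)%:R <=
  n.+1%:R * 'C(n + k, n)%:R ^+ 2 * (theta ^+ 2 / (1 - theta ^+ 2)).
Proof.
have nk0 : 0 < (n + k)%:R :> R by rewrite ltr0n addn_gt0 n0.
have t0 : 0 <= theta by rewrite divr_ge0.
have t1 : theta < 1 by rewrite ltr_pdivrMr // mul1r ltr_nat; lia.
set q := theta ^+ 2; set N := 'C(n + k, n)%:R.
have q1 : 0 < 1 - q by rewrite subr_gt0 expr_lt1.
pose T (i : 'I_n.+1) (j : nat) : R :=
  #|finset (fun x => (x \in S) && (j < tnth x i)%N)|%:R.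
have TE i j : T i j = \sum_(x in S) (j < tnth x i)%N%:R.
  rewrite /T -sum1_card natr_sum.
  rewrite [RHS](eq_bigr (fun x : n.+1.-tuple 'I_k.+1 =>
      if (j < tnth x i)%N then 1 else 0)).
    by rewrite -big_mkcondr; apply: eq_bigl => x; rewrite inE.
  by move=> x _; case: (_ < _)%N.
have Tle i (j : 'I_k) : T i j <= N * theta ^+ j.+1.
  rewrite /T /theta expr_div_n mulrA ler_pdivlMr ?exprn_gt0 //.
  rewrite -!natrX -!natrM ler_nat.
  apply: leq_trans (bin_shift_le n (ltn_ord j)).
  by rewrite leq_mul2r card_simplex_ge ?orbT.
have -> : \sum_(x in S) \sum_(y in S) (overlap x y)%:R =
    \sum_i \sum_(j < k) T i j ^+ 2.
  under eq_bigr => x _.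
    under eq_bigr => y _.
      rewrite overlap_sum_indicator natr_sum.
      under eq_bigr do rewrite natr_sum.
      over.
    rewrite exchange_big /=; under eq_bigr do rewrite exchange_big /=.
    over.
  rewrite exchange_big /=; apply: eq_bigr => i _.
  rewrite exchange_big /=; apply: eq_bigr => j _.
  rewrite expr2 {1}TE big_distrl /=; apply: eq_bigr => x _.
  rewrite TE big_distrr /=; apply: eq_bigr => y _.
  by rewrite -mulnb natrM.
apply: (@le_trans _ _ (\sum_(i < n.+1) N ^+ 2 * (q / (1 - q)))); last first.
  by rewrite sumr_const card_ord -mulrA mulr_natl.
apply: ler_sum => i _.
apply: (@le_trans _ _ (\sum_(j < k) N ^+ 2 * (q * q ^+ j))).
  apply: ler_sum => j _; rewrite -exprS /q -exprM mulnC exprM -exprMn.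
  by rewrite ler_sqr ?nnegrE ?mulr_ge0 ?exprn_ge0.
rewrite -!big_distrr /= ler_wpM2l ?exprn_ge0 //.
rewrite ler_wpM2l ?exprn_ge0 // -[leRHS]mul1r ler_pdivlMr //.
have := subrX1 q k; have : 0 <= q ^+ k by rewrite !exprn_ge0.
move: (q ^+ k) (\sum_(i0 < k) _) => a b; lra.
Qed.
End Overlap.

(** * The weighted simplex as a fractional set *)

Section SimplexDilate.
Variables (R : realType) (n k : nat) (c : R).
Hypotheses (n0 : (0 < n)%N) (c0 : 0 < c) (c1 : c <= 1).
Local Notation S := (simplex n k).

Definition simplex_dilate : int -> R := weighted_image S (@encode n k) c.

Lemma fractional_set_simplex : fractional_set simplex_dilate.
Proof.
split; first exact: fractional_dilate_weighted_image.
move=> z; rewrite /simplex_dilate weighted_imageE.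
apply: le_trans c1; rewrite -[leRHS]mulr1 ler_pM2l // lern1.
apply/card_le1_eqP => x y; rewrite !inE => /andP[_ /eqP xz] /andP[_ /eqP yz].
by apply: encode_inj; rewrite xz yz.
Qed.

Lemma simplex_dilate_size : dilate_size simplex_dilate = c * 'C(n + k, n)%:R.
Proof.
rewrite (fractional_set_size fractional_set_simplex) mass_weighted_image //.
by rewrite card_simplex.
Qed.

(** The exponent 0 is used: sums of two points lie in the simplex of coordinate
    sum 2k. *)
Lemma simplex_sum_size :
  dilate_size (add_dilate 1 simplex_dilate) <= 'C(n + 2 * k, n)%:R.
Proof.
apply: (@le_trans _ _ (\sum_(z \in supp (add_dilate 1 simplex_dilate))
    add_dilate 1 simplex_dilate z `^ 0)).
  by apply: dilate_size_le; rewrite lexx ler01.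
rewrite /simplex_dilate add_dilate_weighted_image -card_simplex.
pose h (p : n.+1.-tuple 'I_k.+1 * n.+1.-tuple 'I_k.+1) :
    n.+1.-tuple 'I_(2 * k).+1 :=
  [tuple inord (tnth p.1 i + tnth p.2 i) | i < n.+1].
have hE p i : tnth (h p) i = (tnth p.1 i + tnth p.2 i)%N :> nat.
  rewrite tnth_mktuple inordK //.
  by have := ltn_ord (tnth p.1 i); have := ltn_ord (tnth p.2 i); lia.
apply: (@supp_weighted_image_card _ _ _ _ _ _ _ _ h).
- by rewrite exprn_gt0.
- move=> [x y]; rewrite finset.in_setX => /andP[/sum_simplex xS /sum_simplex yS].
  rewrite inE big_tuple (eq_bigr _ (fun i _ => hE (x, y) i)) big_split /=.
  by rewrite xS yS; lia.
- move=> p q _ _ pq; rewrite !mul1r; apply/encode_add_eq => i.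
  by rewrite -!hE pq.
Qed.

(** The hypothesis says that the upper bound 2 ln c - n ln (1 - s) - W ln s for
    the logarithm of a value of the difference dilate is negative when W is
    replaced by the bound of [sum_overlap_le] for its mean. *)
Lemma simplex_spartan (s : R) : 0 < s < 1 ->
  let q := (k%:R / (n + k)%:R) ^+ 2 in
  2 * ln c < n%:R * ln (1 - s) + n.+1%:R * (q / (1 - q)) * ln s ->
  strictly_spartan (add_dilate (-1) simplex_dilate).
Proof.
move=> s01 q; set w := q / (1 - q) => c_small.
have cc0 : 0 < c ^+ 2 by rewrite exprn_gt0.
rewrite /simplex_dilate add_dilate_weighted_image /strictly_spartan.
rewrite (sum_weighted_image _ _ cc0 (@ln R)).
set N : R := 'C(n + k, n)%:R.
have N0 : 0 < N by rewrite ltr0n bin_gt0 leq_addr.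
have s0 : ln s < 0 by rewrite ln_lt0.
pose K := 2 * ln c - n%:R * ln (1 - s).
have step p : p \in finset.setX S S ->
    c ^+ 2 * ln (weighted_image (finset.setX S S)
      (fun p => encode p.1 + -1 * encode p.2) (c ^+ 2)
      (encode p.1 + -1 * encode p.2))
    <= c ^+ 2 * (K - (overlap p.1 p.2)%:R * ln s).
  move=> pS; rewrite ler_pM2l //.
  have [p1S p2S] : p.1 \in S /\ p.2 \in S.
    by case: p pS => x y; rewrite finset.in_setX => /andP[].
  have w0 := weighted_image_gt0 (fun p => encode p.1 + -1 * encode p.2) cc0 pS.
  have C0 : 0 < 'C(n + overlap p.1 p.2, n)%:R :> R.
    by rewrite ltr0n bin_gt0 leq_addr.
  apply: (@le_trans _ _ (ln (c ^+ 2 * 'C(n + overlap p.1 p.2, n)%:R))).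
    rewrite ler_ln ?posrE ?mulr_gt0 // weighted_imageE ler_pM2l // ler_nat.
    apply: leq_trans (card_same_difference p1S p2S).
    by apply/eq_leq/eq_card => r; rewrite !inE !mulN1r.
  rewrite lnM ?posrE // lnXn // /K.
  have := ln_bin_le n (overlap p.1 p.2) s01.
  rewrite -[ln c *+ 2]mulr_natl.
  move: (ln _) (ln _) (ln _) (ln _) => a b d e; lra.
apply: (@le_lt_trans _ _ (c ^+ 2 * (N ^+ 2 * K - n.+1%:R * N ^+ 2 * w * ln s))).
  apply: (le_trans (ler_sum _ step)).
  rewrite -big_distrr ler_pM2l //= sumrB sumr_const.
  rewrite cardsX card_simplex -[K *+ _]mulr_natl natrM -expr2 lerD2l lerN2.
  rewrite -big_distrl /=; apply: ler_wnM2r; first exact: ltW.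
  rewrite (eq_bigl (fun p => (p.1 \in S) && (p.2 \in S))); last first.
    by case=> x y; rewrite finset.in_setX.
  rewrite -(pair_big (mem S) (mem S) (fun x y => (overlap x y)%:R)).
  exact: sum_overlap_le.
rewrite pmulr_rlt0 //.
have -> : N ^+ 2 * K - n.+1%:R * N ^+ 2 * w * ln s =
    N ^+ 2 * (K - n.+1%:R * w * ln s) by ring.
rewrite pmulr_rlt0 ?exprn_gt0 // /K.
by move: c_small; move: (ln _) (ln _) (ln _) => a b d; lra.
Qed.

End SimplexDilate.

(** * Numerical bounds on logarithms *)

Lemma derive_nonneg_ge0 (R : realType) (f f' : R -> R) (b : R) :
  (forall x, 0 <= x <= b -> is_derive x 1 f (f' x)) ->
  (forall x, 0 <= x <= b -> 0 <= f' x) ->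
  f 0 = 0 -> forall x, 0 <= x <= b -> 0 <= f x.
Proof.
move=> df f'0 f00 x /andP[x0 xb]; rewrite -f00.
apply: (@ger0_derive1_ndecr R f 0 b) => // [y|y|].
- rewrite in_itv /= => /andP[/ltW y0 /ltW yb].
  by apply: ex_derive; apply: df; rewrite y0.
- rewrite in_itv /= => /andP[/ltW y0 /ltW yb].
  have dfy : is_derive y 1 f (f' y) by apply: df; rewrite y0.
  by rewrite derive1E derive_val; apply: f'0; rewrite y0.
- apply: derivable_within_continuous => y; rewrite in_itv /= => yb.
  by apply: ex_derive; apply: df.
Qed.

Section LogBounds.
Variable R : realType.
Implicit Types x y : R.

Lemma is_derive_ln_ratio x : 0 <= x <= 1 / 2 ->
  is_derive x 1 (fun y => ln (1 + y) - ln (1 - y)) (2 / (1 - x ^+ 2)).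
Proof.
move=> /andP[x0 x1].
have p1 : 0 < 1 + x by lra.
have p2 : 0 < 1 - x by lra.
have d1 : is_derive x 1 (fun y => ln (1 + y)) ((1 + x)^-1 * 1).
  apply: is_derive1_comp; first exact: is_derive1_ln.
  by apply: is_derive_eq; rewrite add0r.
have d2 : is_derive x 1 (fun y => ln (1 - y)) ((1 - x)^-1 * (-1)).
  apply: is_derive1_comp; first exact: is_derive1_ln.
  by apply: is_derive_eq; rewrite add0r mul1r.
apply: is_derive_eq.
by field; rewrite !lt0r_neq0 //; nra.
Qed.

(** Two terms of the series of 2 artanh x. The remainder has derivative
    2 x^4 / (1 - x^2), which lies between 0 and 5 x^4 on [0, 1/2]. *)
Lemma ln_ratio_bounds x : 0 <= x <= 1 / 2 ->
  2 * x + 2 / 3 * x ^+ 3 <= ln ((1 + x) / (1 - x)) <=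
  2 * x + 2 / 3 * x ^+ 3 + x ^+ 5.
Proof.
move=> x01; have /andP[x0 x1] := x01.
have sq y : 0 <= y <= 1 / 2 -> 0 < 1 - y ^+ 2 by move=> /andP[? ?]; nra.
rewrite ln_div ?posrE; [|lra|lra].
apply/andP; split; rewrite -subr_ge0.
- apply: (@derive_nonneg_ge0 R
    (fun y => ln (1 + y) - ln (1 - y) - (2 * y + 2 / 3 * y ^+ 3))
    (fun y => 2 / (1 - y ^+ 2) - (2 + 2 * y ^+ 2))
    (1 / 2)) => [y y01|y y01||]; last exact: x01.
  + have := is_derive_ln_ratio y01 => ?.
    apply: is_derive_eq; rewrite /GRing.scale /=; field.
    by apply: lt0r_neq0; apply: sq.
  + have y2 := sq _ y01.
    have -> : 2 / (1 - y ^+ 2) - (2 + 2 * y ^+ 2) = 2 * y ^+ 4 / (1 - y ^+ 2).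
      by field; apply: lt0r_neq0.
    apply: divr_ge0; last exact: ltW.
    by rewrite mulr_ge0 ?exprn_even_ge0.
  + by rewrite addr0 subr0 ln1 !expr0n /=; lra.
- apply: (@derive_nonneg_ge0 R
    (fun y => 2 * y + 2 / 3 * y ^+ 3 + y ^+ 5 - (ln (1 + y) - ln (1 - y)))
    (fun y => 2 + 2 * y ^+ 2 + 5 * y ^+ 4 - 2 / (1 - y ^+ 2))
    (1 / 2)) => [y y01|y y01||]; last exact: x01.
  + apply: (is_deriveB (df := 2 + 2 * y ^+ 2 + 5 * y ^+ 4)); last first.
      exact: is_derive_ln_ratio.
    have d3 : is_derive y 1 (fun z => 2 * z + 2 / 3 * z ^+ 3) (2 + 2 * y ^+ 2).
      by apply: is_derive_eq; rewrite /GRing.scale /=; field.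
    have d5 : is_derive y 1 (fun z => z ^+ 5) (5 * y ^+ 4).
      have := is_deriveX 5 (is_derive_id y (1 : R)).
      by rewrite /GRing.scale /= mulr1.
    exact: (is_deriveD d3 d5).
  + have y2 := sq _ y01.
    have -> : 2 + 2 * y ^+ 2 + 5 * y ^+ 4 - 2 / (1 - y ^+ 2) =
        y ^+ 4 * (3 - 5 * y ^+ 2) / (1 - y ^+ 2).
      by field; apply: lt0r_neq0.
    apply: divr_ge0; last exact: ltW.
    rewrite mulr_ge0 ?exprn_even_ge0 //.
    have y4 : y ^+ 2 <= 1 / 4 by case/andP: y01 => ? ?; nra.
    by move: (y ^+ 2) y4 => z; lra.
  + by rewrite addr0 subr0 ln1 !expr0n /=; lra.
Qed.

(** With x = 1 / (2n + 1), the ratio (1 + x) / (1 - x) is (n + 1) / n. The odd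
    number 2n + 1 is a separate variable, so that it can be given as a
    numeral. *)
Lemma ln_consecutive_bounds (n : nat) (d : R) :
  (0 < n)%N -> d = n%:R * 2 + 1 ->
  2 * d^-1 + 2 / 3 * d^-1 ^+ 3 <= ln (n.+1%:R) - ln n%:R <=
  2 * d^-1 + 2 / 3 * d^-1 ^+ 3 + d^-1 ^+ 5.
Proof.
move=> n0 dE; have n0' : 1 <= n%:R :> R by rewrite ler1n.
have d3 : 3 <= d by lra.
have d0 : 0 < d by lra.
rewrite -ln_div ?posrE ?ltr0n //.
have -> : n.+1%:R / n%:R = (1 + d^-1) / (1 - d^-1) :> R.
  rewrite -natr1; have -> : n%:R = (d - 1) / 2 by lra.
  by field; rewrite !lt0r_neq0 //; lra.
apply: ln_ratio_bounds.
by rewrite invr_ge0 ltW //= mul1r lef_pV2 ?posrE //; lra.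
Qed.

(** Both sides are linear in the logarithms of 2, 3, 5, 13, 23 and 61. The six
    ratios of consecutive integers 16/15, 25/24, 81/80, 65/64, 24/23 and 61/60
    are multiplicatively independent products of these primes, so their
    logarithms determine the others. In that basis the difference of the sides
    has coefficients of absolute value below 17, and two terms of the artanh
    series are accurate enough for the gap, about 2e-5. *)
Lemma exponent_gap :
  69 * ln 69 - 61 * ln 61 - 8 * ln 8 <
  17354 / 10000 * (65 * ln 65 - 61 * ln 61 - 4 * ln 4 +
    (61 * ln (1 - (4 / 65) ^+ 2) + 16 / 69 * ln ((4 / 65) ^+ 2)) / 2) :> R.
Proof.
have prod (a b : nat) : (0 < a)%N -> (0 < b)%N ->
    ln (a * b)%N%:R = ln a%:R + ln b%:R :> R.
  by move=> a0 b0; rewrite natrM lnM // posrE ltr0n.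
have l4 : ln 4 = ln 2 + ln 2 :> R := prod 2%N 2%N isT isT.
have l8 : ln 8 = ln 2 + ln 4 :> R := prod 2%N 4%N isT isT.
have l16 : ln 16 = ln 2 + ln 8 :> R := prod 2%N 8%N isT isT.
have l15 : ln 15 = ln 3 + ln 5 :> R := prod 3%N 5%N isT isT.
have l24 : ln 24 = ln 3 + ln 8 :> R := prod 3%N 8%N isT isT.
have l25 : ln 25 = ln 5 + ln 5 :> R := prod 5%N 5%N isT isT.
have l9 : ln 9 = ln 3 + ln 3 :> R := prod 3%N 3%N isT isT.
have l81 : ln 81 = ln 9 + ln 9 :> R := prod 9%N 9%N isT isT.
have l80 : ln 80 = ln 5 + ln 16 :> R := prod 5%N 16%N isT isT.
have l64 : ln 64 = ln 8 + ln 8 :> R := prod 8%N 8%N isT isT.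
have l65 : ln 65 = ln 5 + ln 13 :> R := prod 5%N 13%N isT isT.
have l60 : ln 60 = ln 4 + ln 15 :> R := prod 4%N 15%N isT isT.
have l69 : ln 69 = ln 3 + ln 23 :> R := prod 3%N 23%N isT isT.
have -> : ln ((4 / 65) ^+ 2) = (ln 4 - ln 65) * 2 :> R.
  by rewrite mulr_natr lnXn ?divr_gt0 // ln_div ?posrE.
have -> : ln (1 - (4 / 65) ^+ 2) = ln 61 + ln 69 - ln 65 * 2 :> R.
  have -> : 1 - (4 / 65) ^+ 2 = (61 / 65) * (69 / 65) :> R by lra.
  by rewrite lnM ?posrE ?divr_gt0 // !ln_div ?posrE //; lra.
have /andP[_ b15] := @ln_consecutive_bounds 15 31 isT ltac:(lra).
have /andP[_ b24] := @ln_consecutive_bounds 24 49 isT ltac:(lra).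
have /andP[_ b80] := @ln_consecutive_bounds 80 161 isT ltac:(lra).
have /andP[b64 _] := @ln_consecutive_bounds 64 129 isT ltac:(lra).
have /andP[b23 _] := @ln_consecutive_bounds 23 47 isT ltac:(lra).
have /andP[b60 _] := @ln_consecutive_bounds 60 121 isT ltac:(lra).
lra.
Qed.
End LogBounds.

(** * The choice of parameters *)

(** The bound ln x < e x - ln e holds for every e > 0; taking e = d / (2 a)
    leaves half of the linear term to absorb the constants. *)
Lemma linear_beats_ln (R : realType) (a b d : R) : 0 < a -> 0 < d ->
  exists m : nat, (0 < m)%N /\ ln (a * m%:R + 1) + b < m%:R * d.
Proof.
move=> a0 d0; pose e := d / (2 * a).
have e0 : 0 < e by rewrite divr_gt0 ?mulr_gt0.
pose C := e - ln e + b.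
have := archi_boundP (normr_ge0 (C * 2 / d)); set m := Num.bound _ => Cm.
exists m.+1; split => //.
have x0 : 0 < a * m.+1%:R + 1 by rewrite addr_gt0 ?mulr_gt0 ?ltr0n.
have := ln_sublinear (mulr_gt0 e0 x0); rewrite lnM ?posrE // => H.
have ea : e * (a * m.+1%:R + 1) = m.+1%:R * d / 2 + e.
  by rewrite /e; field; rewrite lt0r_neq0.
have : C < m.+1%:R * d / 2.
  rewrite ltr_pdivlMr // -ltr_pdivrMr //.
  apply: (le_lt_trans (ler_norm _)); apply: (lt_trans Cm).
  by rewrite ltr_nat.
rewrite /C; lra.
Qed.

Theorem theorem6 (R : realType) :
  exists a : int -> R,
    [/\ fractional_set a,
        1 < dilate_size a,
        strictly_spartan (add_dilate (-1) a),
        dilate_size (add_dilate (-1) a) = dilate_size a ^+ 2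
      & dilate_size (add_dilate 1 a) <= dilate_size a `^ (17354 / 10000)].
Proof.
pose s : R := (4 / 65) ^+ 2.
have s01 : 0 < s < 1 by rewrite /s; lra.
have ls : ln s < 0 by rewrite ln_lt0.
have ls' : ln (1 - s) < 0 by rewrite ln_lt0 //; lra.
(* [beta], [Y] and [X] are the growth rates in [m] of the logarithms of [c], of
   the number of points of the simplex, and of the bound on its sumset. *)
pose beta := (61 * ln (1 - s) + 16 / 69 * ln s) / 2.
pose Y : R := 65 * ln 65 - 61 * ln 61 - 4 * ln 4.
pose X : R := 69 * ln 69 - 61 * ln 61 - 8 * ln 8.
have gap : X < 17354 / 10000 * (Y + beta) by apply: exponent_gap.
have : 0 < 17354 / 10000 :> R by rewrite divr_gt0 ?ltr0n.
move: (17354 / 10000) gap => e gap e0.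
have [||m [m0 mE]] := @linear_beats_ln R 65 (- ln s)
  (Y + beta - X / e).
- by [].
- by rewrite subr_gt0 ltr_pdivrMr // mulrC.
pose n := (61 * m)%N; pose k := (4 * m)%N.
have n0 : (0 < n)%N by rewrite muln_gt0.
have k0 : (0 < k)%N by rewrite muln_gt0.
have mR : 0 < m%:R :> R by rewrite ltr0n.
(* The extra factor [s] pays for the coordinate by which n + 1 exceeds n in
   [simplex_spartan], and makes the spartan inequality strict. *)
pose c := expR (ln s + m%:R * beta).
have c0 : 0 < c by apply: expR_gt0.
have lc : ln c = ln s + m%:R * beta by rewrite expRK.
have c1 : c <= 1.
  rewrite -expR0 ler_expR.
  have : m%:R * beta < 0 by rewrite pmulr_rlt0 // /beta; lra.
  by lra.
have nkE : (n + k = 65 * m)%N by rewrite /n /k; lia.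
have lnm (j : nat) : (0 < j)%N -> ln (j * m)%:R = ln j%:R + ln m%:R :> R.
  by move=> j0; rewrite natrM lnM // posrE ltr0n.
set N : R := 'C(n + k, n)%:R.
have N0 : 0 < N by rewrite ltr0n bin_gt0 leq_addr.
have lnN : m%:R * Y - ln (65 * m%:R + 1) <= ln N.
  have := @ln_bin_ge R n k n0 k0; rewrite -/N nkE.
  rewrite -[(65 * m).+1%:R]natr1 !lnm // !natrM /Y.
  by lra.
have lnB : ln 'C(n + 2 * k, n)%:R <= m%:R * X :> R.
  (* 8 / 69 is the slope 2k / (n + 2k) at which the bound is tight. *)
  have := @ln_bin_le R n (2 * k) (8 / 69).
  have -> : 1 - 8 / 69 = 61 / 69 :> R by lra.
  rewrite !ln_div ?posrE // => H; apply: le_trans (H _) _; first by lra.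
  by rewrite /n /k !natrM /X; lra.
pose a := simplex_dilate n k c.
have fa : fractional_set a by apply: fractional_set_simplex.
have sa : dilate_size a = c * N by apply: simplex_dilate_size.
have B1 : 1 <= 'C(n + 2 * k, n)%:R :> R by rewrite ler1n bin_gt0 leq_addr.
have cN0 : 0 < c * N by rewrite mulr_gt0.
have big : ln 'C(n + 2 * k, n)%:R < e * ln (c * N).
  apply: (le_lt_trans lnB); rewrite lnM ?posrE // lc.
  have -> : m%:R * X = e * (m%:R * (X / e)) by field; rewrite lt0r_neq0.
  rewrite ltr_pM2l //; move: mE lnN.
  by move: (X / e) (ln N) (ln (65 * m%:R + 1)) => x y z; lra.
have spartan : strictly_spartan (add_dilate (-1) a).
  apply: (@simplex_spartan _ _ _ _ n0 c0 s s01).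
  have -> : (k%:R / (n + k)%:R) ^+ 2 = s :> R.
    by rewrite nkE /k !natrM /s; field; rewrite lt0r_neq0.
  have -> : s / (1 - s) = 16 / 4209.
    have -> : 1 - s = 4209 / 16 * s by rewrite /s; lra.
    by rewrite invfM mulrCA mulfV ?mulr1 ?invf_div // lt0r_neq0 //; lra.
  rewrite lc -[n.+1%:R]natr1 /n natrM /beta.
  by move: (ln s) (ln (1 - s)) ls => x y; lra.
exists a; split => //.
- rewrite sa -ltr_ln ?posrE // ln1.
  by rewrite -(pmulr_rgt0 _ e0) (le_lt_trans (ln_ge0 B1)).
- rewrite (strictly_spartan_size _ spartan); last first.
    by apply: add_dilate_fractional_dilate; have [] := fa.
  rewrite sa /a /simplex_dilate add_dilate_weighted_image.
  rewrite mass_weighted_image ?exprn_gt0 //.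
  by rewrite cardsX card_simplex natrM -expr2 exprMn.
- rewrite sa; apply: le_trans; first exact: simplex_sum_size.
  by rewrite -ler_ln ?posrE ?powR_gt0 ?ltr0n ?bin_gt0 ?leq_addr // ln_powR ltW.
Qed.
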